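(* Let $A\in\mathbb{C}^{m\times n}$ and let $\mathcal{Z}\in\{0,1\}^{m\times n}$ be a sparsity pattern. Let $X\in\mathbb{C}^{m\times n}$ be the minimizer of $J(\cdot\,;A)$ over all matrices $X\in\mathbb{C}^{m\times n}$ satisfying $\mathcal{N}(A)\subseteq\mathcal{N}(X)$, $\mathcal{N}(A^* )\subseteq\mathcal{N}(X^* )$, and $X_{ij}=0$ whenever $\mathcal{Z}_{ij}=0$, and let $J_{min}=J(X;A)$ be the minimum value. Suppose that $J_{min}<\tfrac12$ and that the left and right nullities of $X$ are not greater than those of $A$. Then $$\max\bigl(\kappa(XA^\dagger),\kappa(A^\dagger X)\bigr)\le\frac{1+\sqrt{2J_{min}}}{1-\sqrt{2J_{min}}}.$$
   Context: $\mathcal{N}(\cdot)$ denotes the null-space, $^*$ the conjugate transpose, $^\dagger$ the Moore-Penrose pseudoinverse. The misfit functional is $J(X;A)=\tfrac12\|(X-A)A^\dagger\|_F^2+\tfrac12\|A^\dagger(X-A)\|_F^2$ with Frobenius norms. (The constrained minimizer exists and is unique.) The right nullity of a matrix $B$ is $\dim\mathcal{N}(B)$ and its left nullity is $\dim\mathcal{N}(B^* )$. The generalized condition number of a possibly rank-deficient matrix $B$ is $\kappa(B):=\|B\|_2\|B^\dagger\|_2$ (spectral norms), i.e. the ratio of the largest to the smallest non-zero singular value when $B\ne0$. *)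

(* Defs.v *)
From mathcomp Require Import all_boot all_order all_algebra.
From mathcomp Require Import sesquilinear spectral complex.
From mathcomp Require Import all_classical all_reals.

Set Implicit Arguments.
Unset Strict Implicit.
Unset Printing Implicit Defensive.

Import Order.TTheory GRing.Theory Num.Theory.

Local Open Scope ring_scope.
Local Open Scope sesquilinear_scope.
Local Open Scope classical_set_scope.
Local Open Scope complex_scope.

Notation normc := ComplexField.Normc.normc.

Section Penrose.
Variables (C : numClosedFieldType) (m n : nat).
Implicit Types (A : 'M[C]_(m, n)) (P Q : 'M[C]_(n, m)).

Definition penrose A P :=
  [/\ A *m P *m A = A, P *m A *m P = P,
      (A *m P) ^t* = A *m P & (P *m A) ^t* = P *m A].

(* The default value 0 is never used: see pinvP. *)
Definition pinv A : 'M[C]_(n, m) := xget 0 [set P | penrose A P].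

Lemma penrose_uniq A P Q : penrose A P -> penrose A Q -> P = Q.
Proof.
have trM p q r (M : 'M[C]_(p, q)) (N : 'M[C]_(q, r)) :
    (M *m N) ^t* = N ^t* *m M ^t* by rewrite trmx_mul map_mxM.
move=> [P1 P2 P3 P4] [Q1 Q2 Q3 Q4].
have eqL : A *m P = A *m Q.
  by rewrite -P3 -{1}Q1 -(mulmxA (A *m Q)) trM P3 Q3 mulmxA P1.
have eqR : P *m A = Q *m A.
  by rewrite -P4 -{1}Q1 -mulmxA mulmxA trM P4 Q4 -!mulmxA (mulmxA A) P1.
by rewrite -P2 eqR -mulmxA eqL mulmxA Q2.
Qed.

End Penrose.

Lemma gram_unit (C : numClosedFieldType) r n (F : 'M[C]_(r, n)) :
  row_free F -> F *m F ^t* \in unitmx.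
Proof.
move=> Ffree; rewrite -row_free_unit -kermx_eq0; apply/eqP/row_matrixP => i.
rewrite row0; set u := row i _.
have u0 : u *m (F *m F ^t*) = 0.
  by apply/sub_kermxP; exact: row_sub.
have : dotmx (u *m F) (u *m F) = 0.
  by rewrite dotmxE trmx_mul map_mxM mulmxA -(mulmxA u) u0 mul0mx mxE.
move/eqP; rewrite dnorm_eq0 => /eqP uF0.
by apply/eqP; rewrite -(mulmx_free_eq0 u Ffree) uF0.
Qed.

Lemma pinvP (C : numClosedFieldType) m n (A : 'M[C]_(m, n)) :
  penrose A (pinv A).
Proof.
suff [P hP] : exists P, penrose A P by exact: xgetPex (ex_intro _ P hP).
have trM p q r (M : 'M[C]_(p, q)) (N : 'M[C]_(q, r)) :
    (M *m N) ^t* = N ^t* *m M ^t* by rewrite trmx_mul map_mxM.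
have trV p (M : 'M[C]_p) : (invmx M) ^t* = invmx (M ^t*).
  by rewrite trmx_inv map_invmx.
have : exists r (L : 'M[C]_(m, r)) (F : 'M[C]_(r, n)),
    [/\ A = L *m F, row_free F & row_full L].
  exists (\rank A), (col_base A), (row_base A).
  by rewrite mulmx_base row_base_free col_base_full.
move=> [r [L [F [AE Ffree Lfull]]]].
have FU : F *m F ^t* \in unitmx by exact: gram_unit.
have LU : L ^t* *m L \in unitmx.
  have := @gram_unit C _ _ (L ^t*); rewrite trmxCK; apply.
  by rewrite /row_free mxrank_map mxrank_tr.
set G := invmx (F *m F ^t*); set H := invmx (L ^t* *m L).
have GE : F *m F ^t* *m G = 1%:M by rewrite mulmxV.
have HE : H *m (L ^t* *m L) = 1%:M by rewrite mulVmx.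
pose P := F ^t* *m G *m (H *m L ^t*).
have AP : A *m P = L *m (H *m L ^t*).
  by rewrite AE /P -!mulmxA (mulmxA F) (mulmxA (F *m _)) GE mul1mx.
have PA : P *m A = F ^t* *m G *m F.
  by rewrite AE /P -!mulmxA (mulmxA (L ^t*)) (mulmxA H) HE mul1mx.
exists P; split.
- by rewrite AP AE -!mulmxA (mulmxA (L ^t*)) (mulmxA H) HE mul1mx.
- by rewrite PA /P -!mulmxA (mulmxA F) (mulmxA (F *m _)) GE mul1mx.
- by rewrite AP !trM trmxCK trV trM trmxCK mulmxA.
- by rewrite PA !trM trmxCK trV trM trmxCK mulmxA.
Qed.

Section MatrixNorms.
Variable R : realType.

Definition frobenius m n (B : 'M[R[i]]_(m, n)) : R :=
  Num.sqrt (\sum_i \sum_j normc (B i j) ^+ 2).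

Definition norm2 n (v : 'cV[R[i]]_n) : R :=
  Num.sqrt (\sum_i normc (v i 0) ^+ 2).

(* The unit ball, rather than the unit sphere, keeps the set nonempty when
   n = 0; it is always bounded (has_sup_spectral_norm). *)
Definition spectral_norm m n (B : 'M[R[i]]_(m, n)) : R :=
  sup [set norm2 (B *m v) | v in [set v : 'cV[R[i]]_n | norm2 v <= 1]].

Definition cond_number m n (B : 'M[R[i]]_(m, n)) : R :=
  spectral_norm B * spectral_norm (pinv B).

Lemma has_sup_spectral_norm m n (B : 'M[R[i]]_(m, n)) :
  has_sup [set norm2 (B *m v) | v in [set v : 'cV[R[i]]_n | norm2 v <= 1]].
Proof.
have normc_ge0 (z : R[i]) : 0 <= normc z by case: z => a b; exact: sqrtr_ge0.
have normc_sum (I : finType) (f : I -> R[i]) :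
    normc (\sum_i f i) <= \sum_i normc (f i).
  apply: (big_ind2 (fun x y => normc x <= y)) => //.
    by rewrite ComplexField.Normc.normc0.
  move=> x1 y1 x2 y2 h1 h2.
  exact: le_trans (le_normcD _ _) (lerD h1 h2).
split.
  exists (norm2 (B *m 0)); exists 0 => //=.
  rewrite /norm2 big1 ?sqrtr0 // => i _.
  by rewrite mxE ComplexField.Normc.normc0 expr0n.
exists (Num.sqrt (\sum_i (\sum_j normc (B i j)) ^+ 2)) => _ [v /= v1 <-].
apply: ler_wsqrtr; apply: ler_sum => i _.
rewrite lerXn2r ?nnegrE ?sumr_ge0 // mxE.
apply: le_trans (normc_sum _ _) _; apply: ler_sum => j _.
rewrite ComplexField.Normc.normcM ler_piMr //; apply: le_trans v1.
rewrite /norm2 -[leLHS]ger0_norm // -sqrtr_sqr; apply: ler_wsqrtr.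
by rewrite (bigD1 j) //= lerDl sumr_ge0 // => k _; exact: sqr_ge0.
Qed.

End MatrixNorms.

Definition null_space (F : fieldType) m n (B : 'M[F]_(m, n)) :
  {vspace 'cV[F]_n} := lker (linfun (mulmx B)).

Definition right_nullity (F : fieldType) m n (B : 'M[F]_(m, n)) : nat :=
  \dim (null_space B).

Definition left_nullity (C : numClosedFieldType) m n (B : 'M[C]_(m, n)) : nat :=
  \dim (null_space (B ^t*)).

Section Problem.
Variables (R : realType) (m n : nat).
Implicit Types A X Y : 'M[R[i]]_(m, n).

Definition misfit X A : R :=
  2^-1 * frobenius ((X - A) *m pinv A) ^+ 2
  + 2^-1 * frobenius (pinv A *m (X - A)) ^+ 2.

Definition feasible A (Z : 'M[bool]_(m, n)) X : Prop :=
  [/\ (null_space A <= null_space X)%VS,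
      (null_space (A ^t*) <= null_space (X ^t*))%VS
    & forall i j, Z i j = false -> X i j = 0].

Definition misfit_minimizer A (Z : 'M[bool]_(m, n)) X : Prop :=
  feasible A Z X /\ forall Y, feasible A Z Y -> misfit X A <= misfit Y A.

End Problem.

(* Main.v *)
Require Import Defs.
From mathcomp Require Import all_boot all_order all_algebra.
From mathcomp Require Import complex all_reals.
From mathcomp Require Import sesquilinear spectral classical_sets lra.

Import Order.TTheory GRing.Theory Num.Theory.
Local Open Scope ring_scope.
Local Open Scope complex_scope.

(** Both bounds come from one fact about perturbing an orthogonal projector.
    Write P = A A^+ and Q = A^+ A, the orthogonal projectors onto the ranges of
    A and A^*. Then (X - A) A^+ = X A^+ - P and A^+ (X - A) = A^+ X - Q, and the
    misfit is half the sum of the squares of their Frobenius norms. Hence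
    X A^+ and A^+ X lie within e = sqrt (2 Jmin) < 1 of P and Q respectively,
    in Frobenius norm and a fortiori in spectral norm.

    Now let B be within e of an orthogonal projector P, with B P = B
    ([cond_number_near_orthoproj]). The triangle inequality gives
    |B v| <= (1 + e) |v| for every v, and |B v| >= (1 - e) |v| when P v = v.
    The range of B^+ is that of B^*, which lies in the range of P
    ([pinv_mulmx_proj]); so v = B^+ w satisfies the second bound, while
    B v = B B^+ w is an orthogonal projection of w. Therefore
    (1 - e) |B^+ w| <= |w|, and the product of the two norms is at most
    (1 + e) / (1 - e).

    The condition B P = B is automatic for X A^+, since A^+ A A^+ = A^+; for
    A^+ X it reads A^+ X A^+ A = A^+ X, which follows from the inclusion of the
    null space of A in that of X ([mulmx_pinvK]). *)

Section ConditionNumberBound.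
Local Open Scope sesquilinear_scope.
Set Implicit Arguments.
Unset Strict Implicit.
Variable R : realType.

Lemma norm2_ge0 n (v : 'cV[R[i]]_n) : 0 <= norm2 v.
Proof. exact: sqrtr_ge0. Qed.

Lemma frobenius_ge0 m n (B : 'M[R[i]]_(m, n)) : 0 <= frobenius B.
Proof. exact: sqrtr_ge0. Qed.

Lemma sqr_norm2 n (v : 'cV[R[i]]_n) :
  norm2 v ^+ 2 = \sum_i normc (v i 0) ^+ 2.
Proof. by rewrite sqr_sqrtr // sumr_ge0 // => i _; exact: sqr_ge0. Qed.

Lemma sqr_frobenius m n (B : 'M[R[i]]_(m, n)) :
  frobenius B ^+ 2 = \sum_i \sum_j normc (B i j) ^+ 2.
Proof.
by rewrite sqr_sqrtr // !sumr_ge0 // => i _; rewrite sumr_ge0 // => j _;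
  exact: sqr_ge0.
Qed.

(** This links the real-valued norms to the Hermitian form [dotmx], whose
    Cauchy-Schwarz and triangle inequalities and Pythagorean identity then
    apply to them. *)
Lemma dotmx_normc n (u : 'rV[R[i]]_n) :
  dotmx u u = (\sum_j normc (u 0 j) ^+ 2)%:C.
Proof.
rewrite dotmxE mxE rmorph_sum /=; apply: eq_bigr => j _.
by rewrite !mxE -normCK rmorphXn.
Qed.

Lemma dotmx_norm2 n (v : 'cV[R[i]]_n) : dotmx v^T v^T = (norm2 v ^+ 2)%:C.
Proof.
rewrite dotmx_normc sqr_norm2; congr (_%:C).
by apply: eq_bigr => j _; rewrite mxE.
Qed.

Lemma norm2_sqrtC n (v : 'cV[R[i]]_n) : (norm2 v)%:C = sqrtC (dotmx v^T v^T).
Proof. by rewrite dotmx_norm2 rmorphXn sqrCK // ler0c norm2_ge0. Qed.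

Lemma norm20 n : norm2 (0 : 'cV[R[i]]_n) = 0.
Proof. by apply: complexI; rewrite norm2_sqrtC trmx0 linear0l sqrtC0. Qed.

Lemma norm2N n (v : 'cV[R[i]]_n) : norm2 (- v) = norm2 v.
Proof. by apply: complexI; rewrite !norm2_sqrtC linearN hnormN. Qed.

Lemma norm2D n (u v : 'cV[R[i]]_n) : norm2 (u + v) <= norm2 u + norm2 v.
Proof.
rewrite -lecR rmorphD /= !norm2_sqrtC linearD /=.
exact: (triangle_lerif (@dotmx R[i] n) u^T v^T).1.
Qed.

(** Cauchy-Schwarz, applied row by row. *)
Lemma norm2_mulmx m n (E : 'M[R[i]]_(m, n)) (v : 'cV_n) :
  norm2 (E *m v) <= frobenius E * norm2 v.
Proof.
rewrite -(@ler_pXn2r _ 2) ?nnegrE ?mulr_ge0 ?norm2_ge0 ?frobenius_ge0 //.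
rewrite exprMn sqr_frobenius sqr_norm2 mulr_suml; apply: ler_sum => i _.
(* dotmx conjugates its right argument, so v must be conjugated beforehand. *)
have CS : `|dotmx (row i E) (v ^t*)| ^+ 2
          <= dotmx (row i E) (row i E) * dotmx (v ^t*) (v ^t*).
  exact: (CauchySchwarz (@dotmx R[i] n) _ _).1.
have Ev : dotmx (row i E) (v ^t*) = (E *m v) i 0.
  by rewrite dotmxE trmxCK -row_mul mxE.
have vv : dotmx (v ^t*) (v ^t*) = (norm2 v ^+ 2)%:C.
  rewrite -dotmx_norm2 !dotmxE trmxCK !mxE; apply: eq_bigr => j _.
  by rewrite !mxE mulrC.
move: CS; rewrite Ev vv dotmx_normc -rmorphM /= => {}CS.
rewrite -lecR rmorphXn /=; move: CS; congr (_ <= (_ * _)%:C).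
by apply: eq_bigr => j _; rewrite mxE.
Qed.

(** Pythagoras: P v and v - P v are orthogonal. *)
Lemma norm2_orthoproj n (P : 'M[R[i]]_n) (v : 'cV_n) :
  P *m P = P -> P ^t* = P -> norm2 (P *m v) <= norm2 v.
Proof.
move=> PP Psa; rewrite -(@ler_pXn2r _ 2) ?nnegrE ?norm2_ge0 //.
(* dotmx acts on row vectors, on which P acts from the right as its transpose. *)
have PTsa : P^T ^t* = P^T by rewrite -[in RHS]Psa map_trmx.
have PTPT : P^T *m P^T = P^T by rewrite -trmx_mul PP.
have ort : dotmx (P *m v)^T (v - P *m v)^T = 0.
  rewrite dotmxE linearB /= trmx_mul linearB map_mxB /= trmx_mul map_mxM PTsa.
  by rewrite mulmxBr mulmxA -(mulmxA _ P^T P^T) PTPT subrr mxE.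
rewrite -lecR -!dotmx_norm2 -[v in leRHS](subrKC (P *m v)) linearD hnormDd //.
by rewrite lerDl dnorm_ge0.
Qed.

Lemma spectral_norm_le m n (B : 'M[R[i]]_(m, n)) (c : R) :
  0 <= c -> (forall v, norm2 (B *m v) <= c * norm2 v) -> spectral_norm B <= c.
Proof.
move=> c0 Bc; apply: ge_sup; first exact: (has_sup_spectral_norm B).1.
by move=> _ [v /= v1 <-]; apply: le_trans (Bc v) _; rewrite ler_piMr.
Qed.

Lemma spectral_norm_ge0 m n (B : 'M[R[i]]_(m, n)) : 0 <= spectral_norm B.
Proof.
apply: ub_le_sup; first exact: (has_sup_spectral_norm B).2.
by exists 0; rewrite /= ?mulmx0 norm20.
Qed.

(** B^+ = (B^+ B) B^+ and B^+ B = B^* (B^+)^*, so the range of B^+ lies in that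
    of B^* = P B^*. *)
Lemma pinv_mulmx_proj n (B P : 'M[R[i]]_n) :
  P ^t* = P -> B *m P = B -> P *m pinv B = pinv B.
Proof.
have [_ BBB _ BBs] := pinvP B; move=> Psa BP.
have PBB : P *m (pinv B *m B) = pinv B *m B.
  by rewrite -{1}Psa -BBs -map_mxM -trmx_mul -mulmxA BP.
by rewrite -[in LHS]BBB mulmxA PBB BBB.
Qed.

(** B is bounded above by 1 + e everywhere and below by 1 - e on the range of P,
    where all values of the pseudoinverse lie. *)
Lemma cond_number_near_orthoproj n (B P : 'M[R[i]]_n) (e : R) :
    P *m P = P -> P ^t* = P -> B *m P = B -> frobenius (B - P) <= e -> e < 1 ->
  cond_number B <= (1 + e) / (1 - e).
Proof.
move=> PP Psa BP Be e1.
have e0 : 0 <= e by apply: le_trans Be; exact: frobenius_ge0.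
have se : 0 < 1 - e by lra.
have near (v : 'cV_n) : norm2 ((B - P) *m v) <= e * norm2 v.
  by apply: (le_trans (norm2_mulmx _ _)); rewrite ler_wpM2r ?norm2_ge0.
apply: ler_pM; rewrite ?spectral_norm_ge0 //; apply: spectral_norm_le.
- by lra.
- move=> v; rewrite -[B in leLHS](subrK P) mulmxDl.
  apply: le_trans (norm2D _ _) _; rewrite mulrDl mul1r addrC lerD //.
  exact: norm2_orthoproj.
- by rewrite invr_ge0 ltW.
move=> w; rewrite mulrC ler_pdivlMr //; set v := pinv B *m w.
have Pv : P *m v = v by rewrite mulmxA pinv_mulmx_proj.
(* B B^+ is itself an orthogonal projector. *)
have Bv : norm2 (B *m v) <= norm2 w.
  have [BB _ Bs _] := pinvP B.
  by rewrite mulmxA; apply: norm2_orthoproj => //; rewrite mulmxA BB.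
have : norm2 v <= norm2 (B *m v) + e * norm2 v.
  rewrite -[v in leLHS](_ : B *m v - (B - P) *m v = v); last first.
    by rewrite mulmxBl Pv opprB addrC subrK.
  by apply: le_trans (norm2D _ _) _; rewrite norm2N lerD2l.
by lra.
Qed.

Lemma null_space_sub_mulmx0 (F : fieldType) m n p q (A : 'M[F]_(m, n))
    (X : 'M[F]_(p, n)) (M : 'M[F]_(n, q)) :
  (null_space A <= null_space X)%VS -> A *m M = 0 -> X *m M = 0.
Proof.
move=> sAX AM; apply/matrixP => i j.
have : col j M \in null_space A.
  by rewrite memv_ker lfunE /= colE mulmxA AM mul0mx.
move/(subvP sAX); rewrite memv_ker lfunE /= colE mulmxA -colE.
by move/eqP/colP/(_ i); rewrite !mxE.
Qed.

(** The columns of 1 - A^+ A lie in the null space of A, hence in that of X. *)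
Lemma mulmx_pinvK (C : numClosedFieldType) m n (A X : 'M[C]_(m, n)) :
  (null_space A <= null_space X)%VS -> X *m (pinv A *m A) = X.
Proof.
move=> sAX; have [AAA _ _ _] := pinvP A.
apply/eqP; rewrite eq_sym -subr_eq0 -[X in X - _]mulmx1 -mulmxBr; apply/eqP.
apply: null_space_sub_mulmx0 sAX _.
by rewrite mulmxBr mulmx1 mulmxA AAA subrr.
Qed.

End ConditionNumberBound.

Theorem theorem4p8 (R : realType) (m n : nat)
    (A : 'M[R[i]]_(m, n)) (Z : 'M[bool]_(m, n)) (X : 'M[R[i]]_(m, n))
    (Jmin : R)
    (hX : misfit_minimizer A Z X)
    (hJmin : Jmin = misfit X A)
    (hJ : Jmin < 2^-1)
    (hleft : (left_nullity X <= left_nullity A)%N)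
    (hright : (right_nullity X <= right_nullity A)%N) :
  Num.max (cond_number (X *m pinv A)) (cond_number (pinv A *m X))
    <= (1 + Num.sqrt (2 * Jmin)) / (1 - Num.sqrt (2 * Jmin)).
Proof.
have [[sAX _ _] _] := hX; have [AAA PAP APs PAs] := pinvP A.
set e := Num.sqrt _.
have e1 : e < 1 by rewrite -sqrtr1 ltr_sqrt //; lra.
(* Each of the two squared norms is at most their sum, which is 2 Jmin. *)
have [eL eR] : frobenius (X *m pinv A - A *m pinv A) <= e /\
    frobenius (pinv A *m X - pinv A *m A) <= e.
  rewrite -mulmxBl -mulmxBr.
  have -> : e = Num.sqrt (frobenius ((X - A) *m pinv A) ^+ 2
                         + frobenius (pinv A *m (X - A)) ^+ 2).
    by rewrite /e hJmin /misfit; congr Num.sqrt; lra.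
  set a := frobenius _; set b := frobenius _.
  have [a0 b0] : 0 <= a /\ 0 <= b by split; exact: frobenius_ge0.
  by split; rewrite -[leLHS]ger0_norm // -sqrtr_sqr;
    apply: ler_wsqrtr; rewrite ?lerDl ?lerDr sqr_ge0.
rewrite ge_max; apply/andP; split.
- apply: cond_number_near_orthoproj eL e1 => //.
    by rewrite mulmxA AAA.
  by rewrite -mulmxA (mulmxA (pinv A)) PAP.
- apply: cond_number_near_orthoproj eR e1 => //.
    by rewrite mulmxA PAP.
  by rewrite -mulmxA mulmx_pinvK.
Qed.
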